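(* For nonnegative integers $u,d$ let $$\mathbf{Q}^u_d(y)=\sum_{k=0}^{d}\binom{d}{k}\prod_{i=0}^{k-1}(i+1-r)(i+r)\prod_{i=k+1}^{d}(y+d+r-i)(y+u+r+i)$$ and for nonnegative integers $k$ let $\phi_k(y)=\prod_{i=1}^{k}(y+i)(y+i-1+2r)$. Then for all nonnegative integers $u,d$, $$\mathbf{Q}^u_d(y)\,\phi_u(y)=\mathbf{Q}^d_u(y)\,\phi_d(y).$$
   Context: $y$ and $r$ are indeterminates; the identity is a polynomial identity in $y,r$. *)

(* Defs.v *)
From mathcomp Require Import all_boot all_order all_algebra.
Set Implicit Arguments.
Unset Strict Implicit.
Unset Printing Implicit Defensive.
Import GRing.Theory.
Local Open Scope ring_scope.

(* Q r u d y is Q^u_d(y): u is the superscript, d the subscript. *)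
Definition Q (A : comNzRingType) (r : A) (u d : nat) (y : A) : A :=
  \sum_(0 <= k < d.+1)
    'C(d, k)%:R
    * (\prod_(0 <= i < k) ((i%:R + 1 - r) * (i%:R + r)))
    * (\prod_(k.+1 <= i < d.+1)
         ((y + d%:R + r - i%:R) * (y + u%:R + r + i%:R))).

Definition phi (A : comNzRingType) (r : A) (k : nat) (y : A) : A :=
  \prod_(1 <= i < k.+1) ((y + i%:R) * (y + i%:R - 1 + 2%:R * r)).

(* The two indeterminates of the polynomial ring R[r][y]. *)
Definition indet_y (R : comNzRingType) : {poly {poly R}} := 'X.
Definition indet_r (R : comNzRingType) : {poly {poly R}} := 'X%:P.

(* Main.v *)
Require Import Defs.
From mathcomp Require Import all_boot all_order all_algebra.
From mathcomp Require Import ring.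
Set Implicit Arguments.
Unset Strict Implicit.
Unset Printing Implicit Defensive.
Import GRing.Theory.
Local Open Scope ring_scope.

(** [Q r u d y] is a terminating [3F2] series at [1] with its denominators
    cleared, of Saalschuetzian excess [u + 1].  Sheppard's transformation turns
    it into a series with upper parameters [-d], [-u] and [r], and after
    multiplication by [phi r u y] the result is visibly symmetric in [u] and
    [d].  The case [u = 0] of the transformation is the Pfaff-Saalschuetz sum;
    raising [u] by one changes both sides by the same lower-order series. *)

Section Hypergeometric.
Variable A : comNzRingType.
Implicit Types (a b c x e y r : A) (f g : nat -> A).

Definition rising x n : A := \prod_(i < n) (x + i%:R).

Lemma rising0 x : rising x 0 = 1.
Proof. exact: big_ord0. Qed.

Lemma risingSr x n : rising x n.+1 = rising x n * (x + n%:R).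
Proof. exact: big_ord_recr. Qed.

Lemma risingS x n : rising x n.+1 = x * rising (x + 1) n.
Proof.
rewrite /rising big_ord_recl addr0; congr (_ * _); apply: eq_bigr => i _.
by rewrite -natr1 addrA addrAC.
Qed.

Lemma risingD x m n : rising x (m + n) = rising x m * rising (x + m%:R) n.
Proof.
elim: n => [|n IHn]; first by rewrite addn0 rising0 mulr1.
by rewrite addnS !risingSr IHn natrD; ring.
Qed.

Lemma rising_shift x n :
  rising (x + 1) n.+1 = rising x n.+1 + n.+1%:R * rising (x + 1) n.
Proof. by rewrite risingSr risingS -natr1; ring. Qed.

(** For [n > u] both sides vanish, so an upper parameter [- u] ends a series at [u]; the binomial
    that appears will mirror the one coming from [d]. *)
Lemma rising_oppn u n :
  rising (- u%:R) n = (-1) ^+ n * ('C(u, n) * n`!)%:R :> A.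
Proof.
rewrite bin_ffact; elim: n => [|n IHn]; first by rewrite rising0 mulr1.
rewrite risingSr IHn ffactnSr exprS natrM.
have [le_nu|lt_un] := leqP n u; first by rewrite natrB //; ring.
by rewrite ffact_small //; ring.
Qed.

Definition binsum n f : A := \sum_(k < n.+1) 'C(n, k)%:R * f k.

Lemma eq_binsum n f g :
  (forall k, (k <= n)%N -> f k = g k) -> binsum n f = binsum n g.
Proof. by move=> eq_fg; apply: eq_bigr => k _; rewrite eq_fg // -ltnS. Qed.

Lemma binsumD n f g :
  binsum n (fun k => f k + g k) = binsum n f + binsum n g.
Proof. by rewrite -big_split; apply: eq_bigr => k _; rewrite mulrDr. Qed.

Lemma binsumZ n c f : binsum n (fun k => c * f k) = c * binsum n f.
Proof. by rewrite mulr_sumr; apply: eq_bigr => k _; rewrite mulrCA. Qed.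

Lemma binsumS n f :
  binsum n.+1 f = binsum n f + binsum n (fun k => f k.+1).
Proof.
rewrite /binsum [LHS]big_ord_recl [in RHS]big_ord_recl /= !bin0 -addrA.
congr (_ + _).
under eq_bigr => k _ do rewrite binS natrD mulrDl.
rewrite big_split /=; congr (_ + _).
by rewrite big_ord_recr /= bin_small // mul0r addr0.
Qed.

(** Absorption: this and its companion for [n.+1 - k] turn a linear factor in a term into a series
    of order one less. *)
Lemma binsum_index n f :
  binsum n.+1 (fun k => k%:R * f k) = n.+1%:R * binsum n (fun k => f k.+1).
Proof.
rewrite /binsum big_ord_recl mul0r mulr0 add0r mulr_sumr.
apply: eq_bigr => k _; rewrite lift0 !mulrA -!natrM mulnC.
by rewrite mul_bin_diag.
Qed.

Lemma binsum_coindex n f :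
  binsum n.+1 (fun k => (n.+1 - k)%:R * f k) = n.+1%:R * binsum n f.
Proof.
rewrite /binsum big_ord_recr /= subnn mul0r mulr0 addr0 mulr_sumr.
apply: eq_bigr => k _; rewrite !mulrA -!natrM mulnC.
by rewrite -mul_bin_down.
Qed.

(* [rising x n * rising e n] times the series
   [3F2(-n, a, b; 1 - n - x, e; 1)]. *)
Definition hyp n a b x e : A :=
  binsum n (fun k => rising a k * rising b k * rising x (n - k)
                     * rising (e + k%:R) (n - k)).

Lemma hyp0 a b x e : hyp 0 a b x e = 1.
Proof. by rewrite /hyp /binsum big_ord1 !rising0 !mulr1. Qed.

Lemma hyp_b0 n a x e : hyp n a 0 x e = rising x n * rising e n.
Proof.
rewrite /hyp /binsum big_ord_recl big1 => [|k _].
  by rewrite bin0 !rising0 subn0 !mul1r !addr0.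
by rewrite lift0 (risingS 0) !(mul0r, mulr0).
Qed.

(** Pascal's rule splits the sum. The shifted half frees [a * b]; the other frees [x] and the last
    factor [e + k + (n - k)], which does not depend on [k]. *)
Lemma hypS n a b x e :
  hyp n.+1 a b x e = a * b * hyp n (a + 1) (b + 1) x (e + 1)
                     + x * (e + n%:R) * hyp n a b (x + 1) e.
Proof.
rewrite /hyp binsumS [LHS]addrC -!binsumZ; congr (_ + _); apply: eq_binsum => k le_kn.
  by rewrite subSS !risingS -natr1 addrAC addrA; ring.
rewrite subSn // (risingS x) risingSr -[e + k%:R + _]addrA -natrD subnKC //.
by ring.
Qed.

Lemma hyp_shift_x n a b x e :
  hyp n.+1 a b (x + 1) e =
  hyp n.+1 a b x e + n.+1%:R * ((e + n%:R) * hyp n a b (x + 1) e).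
Proof.
rewrite /hyp -binsumZ -binsum_coindex -binsumD; apply: eq_binsum => k.
rewrite leq_eqVlt => /predU1P[->|lt_kn]; first by rewrite subnn !rising0; ring.
rewrite subSn // rising_shift (risingSr (e + _)) -[e + k%:R + _]addrA -natrD.
by rewrite subnKC //; ring.
Qed.

Lemma hyp_shift_b n a b x e :
  hyp n.+1 a (b + 1) x e =
  hyp n.+1 a b x e + n.+1%:R * (a * hyp n (a + 1) (b + 1) x (e + 1)).
Proof.
(* The value of [k.-1] at [k = 0] is harmless, since [f] only occurs there multiplied by [k]. *)
pose f k := rising a k * rising (b + 1) k.-1 * rising x (n.+1 - k)
            * rising (e + k%:R) (n.+1 - k).
have -> : a * hyp n (a + 1) (b + 1) x (e + 1) = binsum n (fun k => f k.+1).
  rewrite -binsumZ; apply: eq_binsum => k _.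
  by rewrite /f /= subSS risingS -natr1 [e + (_ + _)]addrA [e + _ + 1]addrAC; ring.
rewrite -binsum_index -binsumD; apply: eq_binsum => -[|k] _.
  by rewrite /f !rising0; ring.
by rewrite /f /= rising_shift; ring.
Qed.

(** With [m = n.+1 - k], the two ways of peeling a factor off [rising x m.+1] trade [x] for
    [x + n.+1 - k]; absorption handles the part [- k]. *)
Lemma hyp_mul_x n a b x e :
  x * hyp n.+1 a b (x + 1) e =
  (x + n.+1%:R) * hyp n.+1 a b x e
  - n.+1%:R * (a * b * hyp n (a + 1) (b + 1) x (e + 1)).
Proof.
apply/esym/subr0_eq; pose f k := rising a k * rising b k
  * rising x (n.+1 - k) * rising (e + k%:R) (n.+1 - k).
have -> : a * b * hyp n (a + 1) (b + 1) x (e + 1) = binsum n (fun k => f k.+1).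
  rewrite -binsumZ; apply: eq_binsum => k _.
  by rewrite /f subSS !risingS -natr1 [e + (_ + _)]addrA [e + _ + 1]addrAC; ring.
apply/eqP; rewrite -addrA -opprD subr_eq0 -binsum_index -!binsumZ -binsumD.
apply/eqP/eq_binsum => k le_kn; rewrite /f.
have : rising x (n.+1 - k) * (x + (n.+1 - k)%:R)
       = x * rising (x + 1) (n.+1 - k) by rewrite -risingSr risingS.
rewrite natrB // => eq_x.
have -> : x * (rising a k * rising b k * rising (x + 1) (n.+1 - k)
               * rising (e + k%:R) (n.+1 - k))
  = rising a k * rising b k * rising (e + k%:R) (n.+1 - k)
    * (x * rising (x + 1) (n.+1 - k)) by ring.
by rewrite -eq_x; ring.
Qed.

(** Neither series given by [hypS] is balanced. One contiguous relation in [x] for each makes them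
    so, and the two corrections of lower order cancel. *)
Lemma pfaff_saalschuetz n a b x :
  hyp n a b x (a + b + x) = rising (x + a) n * rising (x + b) n.
Proof.
elim: n => [|n IHn] in a b x *; first by rewrite hyp0 !rising0 mulr1.
rewrite hypS; case: n IHn => [|n] IHn.
  by rewrite !hyp0 !risingSr !rising0; ring.
have -> : hyp n.+1 (a + 1) (b + 1) x (a + b + x + 1) =
    rising (x + a) n.+1 * rising (x + b) n.+1
    + n.+1%:R * ((a + b + x + 1 + n%:R)
                 * hyp n (a + 1) (b + 1) x (a + b + x + 1)).
  (* Lowering [x] by one restores the balance after [a], [b] and [e] have each gone up by one. *)
  have := IHn (a + 1) (b + 1) (x - 1).
  have -> : a + 1 + (b + 1) + (x - 1) = a + b + x + 1 by ring.
  have -> : x - 1 + (a + 1) = x + a by ring.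
  have -> : x - 1 + (b + 1) = x + b by ring.
  by move <-; rewrite -{1 5}[x](subrK 1) hyp_shift_x subrK.
rewrite [x * _]mulrC -[_ * x * _]mulrA hyp_mul_x IHn !(risingSr _ n.+1) -natr1.
by ring.
Qed.

(* Sheppard's transformation, with one upper parameter of the right-hand
   series equal to [- u]. *)
Lemma hyp_transform n u a b x e :
  a + b + x + u%:R = e -> hyp n a b x e = hyp n a (- u%:R) (e - a) (x + a).
Proof.
elim: n u a b x e => [|n IHn] u; first by move=> *; rewrite !hyp0.
elim: u => [|u IHu] a b x e.
  rewrite addr0 => <-; rewrite pfaff_saalschuetz oppr0.
  have -> : a + b + x - a = x + b by ring.
  by rewrite hyp_b0 mulrC.
rewrite -natr1 => def_e.
(* Raising [b] uses up one unit of [u], so [IHu] applies to the shifted series and [IHn] to the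
   correction. On the right the same relation raises [- (u + 1)] to [- u], and the common correction
   cancels without division. *)
have := hyp_shift_b n a b x e.
rewrite (IHu a (b + 1) x e); last by rewrite -def_e; ring.
rewrite (IHn u (a + 1) (b + 1) x (e + 1)); last by rewrite -def_e; ring.
have := hyp_shift_b n a (- (u%:R + 1)) (e - a) (x + a).
have -> : - (u%:R + 1) + 1 = - u%:R :> A by ring.
have -> : e + 1 - (a + 1) = e - a by ring.
rewrite [x + (a + 1)]addrA.
by move=> -> /addIr.
Qed.

Lemma Q_hyp r u d y : Q r u d y = hyp d r (1 - r) (y + r) (y + r + u%:R + 1).
Proof.
rewrite /Q big_mkord; apply: eq_bigr => k _; rewrite -!mulrA; congr (_ * _).
rewrite !mulrA -mulrA; congr (_ * _).
  rewrite big_mkord -big_split; apply: eq_bigr => i _ /=.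
  by ring.
rewrite -(add0n k.+1) big_addn subSS big_mkord big_split /=; congr (_ * _).
  (* The factors [y + d + r - i] decrease with [i]; reversed, they climb from [y + r]. *)
  rewrite (reindex_inj rev_ord_inj); apply: eq_bigr => i _ /=.
  rewrite natrD natrB // natrB; last by rewrite -ltnS ltn_ord.
  by rewrite -!natr1; ring.
by apply: eq_bigr => i _; rewrite natrD -natr1; ring.
Qed.

Lemma phi_rising r k y :
  phi r k y = rising (y + 1) k * rising (y + 2%:R * r) k.
Proof.
rewrite /phi big_add1 big_mkord -big_split; apply: eq_bigr => i _ /=.
by rewrite -natr1; ring.
Qed.

Lemma binsum_widen n m f : (n <= m)%N ->
  binsum n f = \sum_(k < m.+1) 'C(n, k)%:R * f k.
Proof.
move=> le_nm; rewrite /binsum (big_ord_widen m.+1 (fun k => 'C(n, k)%:R * f k)) //.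
rewrite big_mkcond; apply: eq_bigr => k _; case: ltnP => // lt_nk.
by rewrite bin_small // mul0r.
Qed.

(** [rising y u] continues into [rising (y + u) (d - k)], and [rising c u] splits at [k]. Summing up
    to [u + d] makes the range symmetric too; the extra terms have a zero binomial. *)
Lemma hyp_mul_rising u d a c y :
  hyp d a (- u%:R) (y + u%:R) c * (rising y u * rising c u) =
  \sum_(k < (u + d).+1)
    ('C(u, k) * 'C(d, k) * k`!)%:R
    * ((-1) ^+ k * rising a k * rising c k * rising y (u + d - k)
       * (rising (c + k%:R) (u - k) * rising (c + k%:R) (d - k))).
Proof.
rewrite /hyp (binsum_widen _ (leq_addl u d)) mulr_suml.
apply: eq_bigr => k _; rewrite rising_oppn.
have [le_ku|lt_uk] := leqP k u; last by rewrite (bin_small lt_uk) !mul0n; ring.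
have [le_kd|lt_dk] := leqP k d; last by rewrite (bin_small lt_dk) muln0 mul0n; ring.
rewrite -(addnBA _ le_kd) risingD !natrM.
have -> : rising c u = rising c k * rising (c + k%:R) (u - k).
  by rewrite -risingD subnKC.
by ring.
Qed.

End Hypergeometric.

Theorem theorem4p6 (R : comNzRingType) (u d : nat) :
  let y := indet_y R in
  let r := indet_r R in
  Q r u d y * phi r u y = Q r d u y * phi r d y.
Proof.
move=> y r.
(* The two factors of [phi] are exactly those that [hyp_mul_rising] needs, at base [y + 1] and with
   [c = y + 2r]. *)
have QE v n : Q r v n y * phi r v y =
    hyp n r (- v%:R) (y + 1 + v%:R) (y + 2%:R * r)
    * (rising (y + 1) v * rising (y + 2%:R * r) v).
  rewrite Q_hyp (@hyp_transform _ _ v) ?phi_rising; last by ring.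
  by congr (hyp _ _ _ _ _ * _); ring.
rewrite !QE !hyp_mul_rising addnC; apply: eq_bigr => k _.
by rewrite [('C(u, k) * _)%N]mulnC [rising _ (u - k) * _]mulrC.
Qed.
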